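(* Irreducible nonequivalent $*$-representations of $\mathcal P_{1,com}$ generate all nonisomorphic transitive systems of one subspace of a Hilbert space. Precisely: the system $(H;P_1H)$ generated by any irreducible $*$-representation of $\mathcal P_{1,com}$ is transitive; nonequivalent irreducible $*$-representations generate nonisomorphic systems; and every transitive system $(H;H_1)$ of one subspace of a (finite or infinite dimensional) Hilbert space $H$ is isomorphic to the system generated by some irreducible $*$-representation of $\mathcal P_{1,com}$.
   Context: All Hilbert spaces are complex and nonzero; subspaces are closed; $B(H)$ denotes the bounded linear operators on $H$. A system of $n$ subspaces is a tuple $S=(H;H_1,\ldots,H_n)$, where $H$ is a Hilbert space and $H_1,\ldots,H_n$ are subspaces of $H$. Two systems $S=(H;H_1,\ldots,H_n)$ and $\tilde S=(\tilde H;\tilde H_1,\ldots,\tilde H_n)$ are isomorphic if there is a bounded linear bijection $R:H\to\tilde H$ with $R(H_i)=\tilde H_i$ for all $i=1,\ldots,n$. Put $\mathrm{End}(S)=\{R\in B(H): R(H_i)\subset H_i,\ i=1,\ldots,n\}$. The system $S$ is transitive if $\mathrm{End}(S)=\mathbb C I_H$. $\mathcal P_{n,com}$ is the unital $*$-algebra generated by $p_1,\ldots,p_n$ with relations $p_k^2=p_k^*=p_k$ and $[\sum_{k=1}^n p_k,p_i]=0$ for all $i=1,\ldots,n$. A $*$-representation of $\mathcal P_{n,com}$ on a Hilbert space $H$ is a tuple $(P_1,\ldots,P_n)$ of orthogonal projections on $H$ such that $\sum_k P_k$ commutes with every $P_i$. It is irreducible if $P_1,\ldots,P_n$ have no common invariant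 closed subspaces other than $0$ and $H$. Representations $(P_i)$ on $H$ and $(\tilde P_i)$ on $\tilde H$ are (unitarily) equivalent if there is a unitary operator $R:H\to\tilde H$ with $RP_i=\tilde P_iR$ for all $i$. The system generated by $(P_1,\ldots,P_n)$ is $(H;P_1H,\ldots,P_nH)$. *)

(* Defs.v *)
From HB Require Import structures.
From mathcomp Require Import all_boot all_order all_algebra.
From mathcomp Require Import sesquilinear complex.
From mathcomp Require Import boolp classical_sets functions reals.
From mathcomp Require Import topology normedtype.

Set Implicit Arguments.
Unset Strict Implicit.
Unset Printing Implicit Defensive.

Import Order.TTheory GRing.Theory Num.Theory.
Import numFieldNormedType.Exports.

Local Open Scope classical_set_scope.
Local Open Scope ring_scope.
Local Open Scope complex_scope.

(* The inner product is linear in its first argument and conjugate-linear in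
   the second one. *)
Record hilbert (R : realType) := Hilbert {
  hilbert_sort :> completeNormedModType R[i];
  inner : {dot hilbert_sort for @Num.conj R[i]};
  innerE : forall x, inner x x = `|x| ^+ 2;
  hilbert_neq0 : exists x : hilbert_sort, x != 0
}.
Arguments inner {R h}.

Section Operators.
Variables (R : realType) (H K : hilbert R).

Definition bounded_op (T : {linear H -> K}) :=
  exists M : R[i], forall x, `|T x| <= M * `|x|.

Definition unitary_op (T : {linear H -> K}) :=
  bijective T /\ (forall x y, inner (T x) (T y) = inner x y).

End Operators.

Section Subspaces.
Variables (R : realType) (H : hilbert R).

Definition closed_subspace (A : set H) := submod_closed (mem A) /\ closed A.

(* The last two clauses are P^2 = P and P^* = P. *)
Definition orthoproj (P : {linear H -> H}) :=
  [/\ bounded_op P, forall x, P (P x) = P x &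
      forall x y, inner (P x) y = inner x (P y)].

Lemma orthoproj_closed_subspace (P : {linear H -> H}) :
  orthoproj P -> closed_subspace (range P).
Proof.
move=> [[M PM] PP _]; split.
  split=> [|a _ _ /set_mem[x _ <-] /set_mem[y _ <-]]; apply/mem_set.
    by exists 0; rewrite ?linear0.
  by exists (a *: x + y); rewrite ?linearP.
have cP : continuous P.
  apply/bounded_linear_continuous/ex_bound; exists `|M|.
  apply/nbhs_norm0P; exists 1 => //= x /= /ltW x1.
  have MP : 0 <= M * `|x| by apply: le_trans (PM x).
  by rewrite (le_trans (PM x))// -(ger0_norm MP) normrM normr_id ler_piMr.
have -> : range P = (fun x => P x - x) @^-1` [set 0].
  apply/seteqP; split=> [_ [x _ <-]|x /= /eqP] /=; first by rewrite PP subrr.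
  by rewrite subr_eq0 => /eqP Px; exists x.
apply: preimage_closed; last first.
  by apply: accessible_closed_set1; apply: hausdorff_accessible; exact: norm_hausdorff.
by move=> x _; apply: continuousB; [exact: cP|exact: cvg_id].
Qed.

End Subspaces.

Record system (R : realType) (n : nat) := System {
  sys_space : hilbert R;
  sys_sub : 'I_n -> set sys_space;
  sys_subP : forall i, closed_subspace (sys_sub i)
}.

Arguments sys_sub {R n} s i : rename.

Definition sys_iso (R : realType) (n : nat) (S S' : system R n) :=
  exists T : {linear sys_space S -> sys_space S'},
    [/\ bounded_op T, bijective T &
        forall i, T @` sys_sub S i = sys_sub S' i].

Definition sys_End (R : realType) (n : nat) (S : system R n) :
    set {linear sys_space S -> sys_space S} :=
  [set T | bounded_op T /\ forall i, T @` sys_sub S i `<=` sys_sub S i].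

Arguments sys_End {R n} S _.

Definition transitive_sys (R : realType) (n : nat) (S : system R n) :=
  sys_End S = [set T | exists c : R[i], forall x, T x = c *: x].

Record com_rep (R : realType) (n : nat) := ComRep {
  rep_space : hilbert R;
  rep_op : 'I_n -> {linear rep_space -> rep_space};
  rep_opP : forall k, orthoproj (rep_op k);
  rep_com : forall i x,
    \sum_(k < n) rep_op k (rep_op i x) = rep_op i (\sum_(k < n) rep_op k x)
}.

Arguments rep_op {R n} c k : rename.

Definition irreducible_rep (R : realType) (n : nat) (P : com_rep R n) :=
  forall A : set (rep_space P), closed_subspace A ->
    (forall i, rep_op P i @` A `<=` A) -> A = [set 0] \/ A = setT.

Definition equivalent_rep (R : realType) (n : nat) (P Q : com_rep R n) :=
  exists2 T : {linear rep_space P -> rep_space Q},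
    unitary_op T & forall i x, T (rep_op P i x) = rep_op Q i (T x).

Definition generated_sys (R : realType) (n : nat) (P : com_rep R n) :
    system R n :=
  System (fun i => orthoproj_closed_subspace (rep_opP P i)).

(* Main.v *)
(* In both directions the space turns out to be a line. For a unit vector e,
   the orthogonal projection [line_proj e] onto the line C e is bounded.
   For an irreducible projection P, the line of any unit e with P e = e or
   P e = 0 is closed and invariant, hence everything. For a transitive system
   (H; H_1), pick e in H_1 when H_1 != 0 and arbitrarily otherwise:
   [line_proj e] maps H_1 into H_1, so it is a scalar, which forces H = C e
   without appealing to the projection theorem. *)
Require Import Defs.
From HB Require Import structures.
From mathcomp Require Import all_boot all_order all_algebra.
From mathcomp Require Import sesquilinear complex.
From mathcomp Require Import boolp classical_sets functions reals.
From mathcomp Require Import topology normedtype.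

Set Implicit Arguments.
Unset Strict Implicit.
Unset Printing Implicit Defensive.

Import Order.TTheory GRing.Theory Num.Theory.
Import numFieldNormedType.Exports.

Local Open Scope classical_set_scope.
Local Open Scope ring_scope.

Section LineProjection.
Variables (R : realType) (H : hilbert R).
Implicit Types (e x y z : H) (A : set H).

Lemma inner_conj x y : inner y x = (inner x y)^*.
Proof. by rewrite hermC expr0 mul1r. Qed.

Lemma innerZl (a : R[i]) x y : inner (a *: x) y = a * inner x y.
Proof. exact: linearZl_LR. Qed.

Lemma innerZr (a : R[i]) x y : inner x (a *: y) = a^* * inner x y.
Proof. exact: linearZr_LR. Qed.

Lemma innerBl x y z : inner (x - y) z = inner x z - inner y z.
Proof. exact: linearBl. Qed.

Lemma innerBr x y z : inner z (x - y) = inner z x - inner z y.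
Proof. exact: linearBr. Qed.

Lemma innerZ (a b : R[i]) x y :
  inner (a *: x) (b *: y) = a * b^* * inner x y.
Proof. by rewrite innerZl innerZr mulrA. Qed.

Lemma unit_inner e : `|e| = 1 -> inner e e = 1.
Proof. by move=> e1; rewrite innerE e1 expr1n. Qed.

Lemma unit_neq0 e : `|e| = 1 -> e != 0.
Proof. by move=> e1; rewrite -normr_eq0 e1 oner_eq0. Qed.

Lemma unit_normalize x : x != 0 -> `|(`|x|^-1 *: x)| = 1.
Proof.
by move=> x0; rewrite normrZ normfV normr_id mulVf// normr_eq0.
Qed.

Definition line_proj e x : H := inner x e *: e.

Lemma line_proj_is_linear e : linear (line_proj e).
Proof. by move=> a x y; rewrite /line_proj linearPl scalerDl scalerA. Qed.

HB.instance Definition _ e :=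
  GRing.isLinear.Build _ _ _ _ (line_proj e) (line_proj_is_linear e).

Lemma line_projZ e (a : R[i]) : `|e| = 1 -> line_proj e (a *: e) = a *: e.
Proof.
by move=> e1; rewrite /line_proj innerZl unit_inner// mulr1.
Qed.

Lemma line_proj_id e : `|e| = 1 -> line_proj e e = e.
Proof. by move=> e1; rewrite /line_proj unit_inner// scale1r. Qed.

(** Cauchy-Schwarz against a unit vector: for [w] the component of [x] orthogonal to [e], expanding
    [inner w w] leaves [|x|^2 - |inner x e|^2], which is therefore nonnegative. *)
Lemma normr_inner_unit e x : `|e| = 1 -> `|inner x e| <= `|x|.
Proof.
move=> e1; rewrite -(ler_pXn2r (n := 2))// ?nnegrE//.
pose w := x - inner x e *: e.
have : 0 <= inner w w by rewrite innerE exprn_ge0.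
rewrite /w innerBl !innerBr !innerZl !innerZr (unit_inner e1) (innerE x).
rewrite (inner_conj x e) mulr1 -normCK subrr subr0.
by rewrite -normCKC subr_ge0.
Qed.

(** This yields both the closedness of the line, needed to apply irreducibility, and the boundedness
    of [line_proj e], needed to apply transitivity. *)
Lemma orthoproj_line_proj e : `|e| = 1 -> orthoproj (line_proj e).
Proof.
move=> e1; split.
- by exists 1 => x; rewrite mul1r normrZ e1 mulr1 normr_inner_unit.
- by move=> x; rewrite /= line_projZ.
- move=> x y; rewrite /= /line_proj innerZl innerZr.
  by rewrite -inner_conj mulrC.
Qed.

(** A nonzero [x] in [A] is a nonzero multiple of [e], so [A] contains [e] and hence the whole
    line. *)
Lemma line_closed_subspace_dichotomy e A :
    (forall x, line_proj e x = x) -> closed_subspace A ->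
  A = [set 0] \/ A = setT.
Proof.
move=> eP [[A0 Asub] _].
have {}A0 : A 0 by exact: set_mem.
have Ascale (a : R[i]) x : A x -> A (a *: x).
  move=> Ax; rewrite -[_ *: _]addr0; apply: set_mem.
  by apply: Asub; exact: mem_set.
have [[x [Ax x0]]|nA] := pselect (exists x, A x /\ x != 0); [right|left].
  have xe0 : inner x e != 0.
    by apply: contra_neq x0 => xe; rewrite -(eP x) /line_proj xe scale0r.
  apply/seteqP; split=> // y _; rewrite -(eP y) /line_proj.
  (* Writes [e] as [(inner x e)^-1] times [x], so that the goal becomes a double multiple of [x]. *)
  rewrite -[e](scalerK xe0) -/(line_proj e x) eP.
  exact/Ascale/Ascale.
apply/seteqP; split=> [x Ax|_ ->//].
by apply/eqP; apply: contrapT => /negP x0; apply: nA; exists x.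
Qed.

Lemma orthoproj_range_id (P : {linear H -> H}) :
  orthoproj P -> range P = setT -> forall x, P x = x.
Proof.
move=> [_ PP _] PT x; have [y _ <-] : range P x by rewrite PT.
exact: PP.
Qed.

Lemma range0_linear_eq0 (P : {linear H -> H}) :
  range P = [set 0] -> forall x, P x = 0.
Proof. by move=> P0 x; have : range P (P x) by []; rewrite P0. Qed.

End LineProjection.

Lemma irreducible_rep_line (R : realType) (P : com_rep R 1) :
  irreducible_rep P ->
  exists2 e : rep_space P, `|e| = 1 & forall x, line_proj e x = x.
Proof.
move=> irrP; have [[_ PP _] i0] := (rep_opP P ord0, ord1).
set p := rep_op P ord0 in PP.
(* A unit eigenvector is enough for an invariant line: [c] is 1 if [e] comes from the range of [p],
   and 0 if [p] vanishes identically. *)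
have [e e1 [c pe]] : exists2 e, `|e| = 1 & exists c : R[i], p e = c *: e.
  have [[x px]|np] := pselect (exists x, p x != 0).
    exists (`|p x|^-1 *: p x); first exact: unit_normalize.
    by exists 1; rewrite linearZ PP scale1r.
  have [x x0] := hilbert_neq0 (rep_space P).
  exists (`|x|^-1 *: x); first exact: unit_normalize.
  exists 0; rewrite scale0r; apply/eqP; apply: contrapT => /negP px.
  by apply: np; eexists; exact: px.
exists e => //.
have [||r0|rT] := irrP (range (line_proj e)).
- exact/orthoproj_closed_subspace/orthoproj_line_proj.
- move=> i _ [_ [x _ <-] <-]; rewrite i0 -/p /line_proj.
  rewrite linearZ /= pe scalerA; exists ((inner x e * c) *: e) => //.
  exact: line_projZ.
- have e0 : line_proj e e = 0 := range0_linear_eq0 r0 e.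
  by move: (unit_neq0 e1); rewrite -(line_proj_id e1) e0 eqxx.
- exact: orthoproj_range_id (orthoproj_line_proj e1) rT.
Qed.

Lemma irreducible_rep_transitive (R : realType) (P : com_rep R 1) :
  irreducible_rep P -> transitive_sys (generated_sys P).
Proof.
move=> /irreducible_rep_line[e e1 eP].
apply/seteqP; split=> /= T; last first.
  move=> [c Tc]; split.
    by exists `|c| => x; rewrite Tc normrZ.
  move=> i _ [_ [x _ <-] <-]; rewrite Tc.
  by exists (c *: x); rewrite ?linearZ.
(* The vector [T e] lies on the line of [e], and its coordinate there is the scalar by which [T]
   acts. *)
move=> _; exists (inner (T e) e) => x.
rewrite -[in LHS](eP x) linearZ /= -[in LHS](eP (T e)) /line_proj.
by rewrite scalerA mulrC -scalerA -/(line_proj e x) eP.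
Qed.

(** An isomorphism out of a line differs from a unitary only by a positive factor, and rescaling
    does not affect the intertwining relation. *)
Lemma irreducible_rep_iso_equivalent (R : realType) (P Q : com_rep R 1) :
  irreducible_rep P -> irreducible_rep Q ->
  sys_iso (generated_sys P) (generated_sys Q) -> equivalent_rep P Q.
Proof.
move=> /irreducible_rep_line[e e1 eP] _ [T [_ bT TPQ]].
have {}TPQ := TPQ ord0; rewrite /= in T bT TPQ.
have Te0 : T e != 0.
  apply: contraNneq (unit_neq0 e1) => Te; apply/eqP/(bij_inj bT).
  by rewrite Te linear0.
(* With this factor [k *: T e] is a unit vector, so [k \*: T] preserves inner products. *)
pose k : R[i] := `|T e|^-1.
have k0 : k != 0 by rewrite invr_eq0 normr_eq0.
exists (k \*: T) => [|i x].
  split.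
    have [T' TK T'K] := bT; exists (fun y => T' (k^-1 *: y)) => x /=.
      by rewrite scalerK.
    by rewrite T'K scalerKV.
  have TE x : T x = inner x e *: T e.
    by rewrite -[in LHS](eP x) /line_proj linearZ.
  have kC (a : R[i]) : k *: (a *: T e) = a *: (k *: T e).
    by rewrite !scalerA mulrC.
  have kTe : inner (k *: T e) (k *: T e) = 1.
    by rewrite unit_inner// unit_normalize.
  move=> x y /=; rewrite TE (TE y) !kC innerZ kTe.
  by rewrite -[in RHS](eP x) -[in RHS](eP y) innerZ unit_inner.
rewrite (ord1 i) /=.
(* The projection of [P] is 0 or the identity; since [T] maps its range onto that of [Q], the
   projection of [Q] is of the same kind. *)
have [P0|PT] := line_closed_subspace_dichotomy eP
    (orthoproj_closed_subspace (rep_opP P ord0)).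
  have Q0 : range (rep_op Q ord0) = [set 0].
    by rewrite -TPQ P0 image_set1 linear0.
  by rewrite (range0_linear_eq0 P0) (range0_linear_eq0 Q0) linear0 scaler0.
have QT : range (rep_op Q ord0) = setT.
  rewrite -TPQ PT; apply/seteqP; split=> // y _.
  by have [T' _ T'K] := bT; exists (T' y).
by rewrite (orthoproj_range_id (rep_opP P ord0) PT)
  (orthoproj_range_id (rep_opP Q ord0) QT).
Qed.

Lemma transitive_sys_line (R : realType) (S : system R 1) :
  transitive_sys S ->
  exists2 e : sys_space S, `|e| = 1 & forall x, line_proj e x = x.
Proof.
move=> trS; have [[S0 Ssub] _] := sys_subP S ord0.
have Sscale (a : R[i]) x : sys_sub S ord0 x -> sys_sub S ord0 (a *: x).
  move=> Sx; rewrite -[_ *: _]addr0; apply: set_mem.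
  by apply: Ssub; [exact: mem_set|].
have [e e1 eS] : exists2 e : sys_space S, `|e| = 1 &
    line_proj e @` sys_sub S ord0 `<=` sys_sub S ord0.
  have [[x [Sx x0]]|nS] := pselect (exists x, sys_sub S ord0 x /\ x != 0).
    exists (`|x|^-1 *: x); first exact: unit_normalize.
    (* The image of [y] is [inner y e] times [|x|^-1] times [x], a double multiple of a vector of
       the subspace. *)
    by move=> _ [y _ <-]; exact/Sscale/Sscale.
  have [x x0] := hilbert_neq0 (sys_space S).
  exists (`|x|^-1 *: x); first exact: unit_normalize.
  move=> _ [y Sy <-]; have -> : y = 0.
    by apply/eqP; apply: contrapT => /negP y0; apply: nS; exists y.
  by rewrite linear0; exact: set_mem.
have [boundedp _ _] := orthoproj_line_proj e1.
have : sys_End S (line_proj e) by split=> // i; rewrite (ord1 i).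
rewrite trS => -[c ec]; exists e => // x.
(* Evaluating at the fixed vector [e] gives [e = c *: e], hence [c = 1] and [line_proj e] is the
   identity. *)
have /eqP := ec e; rewrite /= line_proj_id// -[X in X == _]scale1r -subr_eq0.
rewrite -scalerBl scaler_eq0 (negPf (unit_neq0 e1)) orbF subr_eq0 => /eqP c1.
by have := ec x; rewrite /= -c1 scale1r.
Qed.

(** On a line the given subspace is 0 or everything, so the zero map or the identity projects onto
    it. The system is then literally the generated one, and the identity map is the isomorphism. *)
Lemma transitive_sys_generated (R : realType) (S : system R 1) :
  transitive_sys S ->
  exists2 P : com_rep R 1,
    irreducible_rep P & sys_iso S (generated_sys P).
Proof.
move=> /transitive_sys_line[e e1 eP].
have [E pE rE] : exists2 E : {linear sys_space S -> sys_space S},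
    orthoproj E & range E = sys_sub S ord0.
  have [->|->] := line_closed_subspace_dichotomy eP (sys_subP S ord0).
    exists (\0 : {linear _ -> _}).
      split=> [|//|x y /=]; last by rewrite linear0l linear0r.
      by exists 0 => x; rewrite mul0r normr0.
    by apply/seteqP; split=> [_ [x _ <-]//|_ ->]; exists 0.
  exists (idfun : {linear _ -> _}); last by rewrite image_id.
  by split=> //; exists 1 => x; rewrite mul1r.
have com (i : 'I_1) x : \sum_(k < 1) E (E x) = E (\sum_(k < 1) E x).
  by rewrite !big_ord1.
exists (@ComRep R 1 _ (fun=> E) (fun=> pE) com).
  by move=> A cA _; exact: line_closed_subspace_dichotomy eP cA.
exists (idfun : {linear _ -> _}); split.
- by exists 1 => x; rewrite mul1r.
- by exists id.
- by move=> i; rewrite image_id (ord1 i) /= rE.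
Qed.

Theorem proposition5 (R : realType) :
  [/\ (forall P : com_rep R 1,
         irreducible_rep P -> transitive_sys (generated_sys P)),
      (forall P Q : com_rep R 1,
         irreducible_rep P -> irreducible_rep Q ->
         ~ equivalent_rep P Q ->
         ~ sys_iso (generated_sys P) (generated_sys Q)) &
      (forall S : system R 1,
         transitive_sys S ->
         exists2 P : com_rep R 1,
           irreducible_rep P & sys_iso S (generated_sys P))].
Proof.
split.
- exact: irreducible_rep_transitive.
- by move=> P Q irrP irrQ nPQ /(irreducible_rep_iso_equivalent irrP irrQ).
- exact: transitive_sys_generated.
Qed.
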